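(* Let $n\ge 1$, let $a_1,\dots,a_n$ be distinct real numbers, and let $F(a)=\sum_{k=0}^n A_k a^k=\prod_{i=1}^n(a-a_i)$. Fix signs $\epsilon_i\in\{\pm1\}$ and real numbers $\xi_1,\dots,\xi_n,\nu_n$, put $\Delta_i=\epsilon_i(a-a_i)$ and $$x(a)=\frac{\nu_n}{2}\,a+\sum_{i=1}^n\frac{\xi_i}{\sqrt{\Delta_i}},$$ and work on an open interval $I\subset(0,\infty)$ on which all $\Delta_i>0$ and $\dot x=dx/da\neq0$. On $M=I\times\mathbb{R}$ with coordinates $(a,y)$ consider $H=\Pi^2+a\,P_y^2$ with $\Pi=\frac{a}{\dot x}P_a$. Define $$G=\sum_{k=0}^n A_{n-k}H^{n-k}P_y^{2k+1},\quad Q_1=\sum_{k=0}^n\tilde b_k\,H^{n-k}\,\Pi\,P_y^{2k},\quad Q_2=\sum_{k=0}^n\tilde c_k\,H^{n-k}P_y^{2k+1},$$ where for $k=0,\dots,n$ $$\tilde b_k=(-1)^k\Big(\nu_n\sigma_k+\sum_{i=1}^n\frac{\xi_i}{\sqrt{\Delta_i}}\sigma^i_{k-1}\Big),$$ $$\tilde c_k=\frac{(-1)^{k+1}}{2}\Big\{\nu_n^2\,a\,\sigma_k+2\nu_n\sum_{i=1}^n\frac{\xi_i}{\sqrt{\Delta_i}}\big(\sigma^i_k+a\,\sigma^i_{k-1}\big)+\sum_{i=1}^n\frac{\xi_i^2}{\Delta_i}\sigma^i_{k-1}+\sum_{i\neq j}\frac{\xi_i\xi_j}{\sqrt{\Delta_i\Delta_j}}\big(\sigma^{ij}_{k-1}+a\,\sigma^{ij}_{k-2}\big)\Big\},$$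 and set $S_1=Q_1+y\,G$, $S_2=Q_2+y\,Q_1+\frac{y^2}{2}G$. Then $\{H,P_y\}=\{H,S_1\}=\{H,S_2\}=0$ and each of the triples $(H,P_y,S_1)$, $(H,P_y,S_2)$ is functionally independent; thus $\{H,P_y,S_1\}$ and $\{H,P_y,S_2\}$ are two maximally superintegrable systems.
   Context: $\{\cdot,\cdot\}$ is the canonical Poisson bracket on $T^*M$, $(P_a,P_y)$ the momenta conjugate to $(a,y)$; $H$ is the geodesic Hamiltonian of $g=\dot x^2a^{-2}da^2+a^{-1}dy^2$. Symmetric functions of the roots: $\sigma_k$ ($0\le k\le n$) by $\prod_{i}(a-a_i)=\sum_{k=0}^n(-1)^k\sigma_k a^{n-k}$; for each $i$, $\sigma^i_m$ ($-1\le m\le n$) by $\prod_{l\neq i}(a-a_l)=\sum_{m=0}^{n-1}(-1)^m\sigma^i_m a^{n-1-m}$ with $\sigma^i_{-1}=\sigma^i_n=0$; for $i\neq j$, $\sigma^{ij}_m$ ($-2\le m\le n$) by $\prod_{l\neq i,j}(a-a_l)=\sum_{m=0}^{n-2}(-1)^m\sigma^{ij}_m a^{n-2-m}$ with $\sigma^{ij}_{-2}=\sigma^{ij}_{-1}=\sigma^{ij}_{n-1}=\sigma^{ij}_n=0$. *)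

(* Defs.v *)
From HB Require Import structures.
From mathcomp Require Import all_boot all_order all_algebra.
From mathcomp Require Import all_classical all_reals all_analysis.
Set Implicit Arguments. Unset Strict Implicit. Unset Printing Implicit Defensive.
Import Order.TTheory GRing.Theory Num.Theory.
Local Open Scope ring_scope.

Section Defs.
Variable R : realType.

(* phase-space functions on T^*M, arguments (a, y, P_a, P_y) *)
Definition pfun := R -> R -> R -> R -> R.

Definition d_a (f : pfun) a y pa py := derive1 (fun t => f t y pa py) a.
Definition d_y (f : pfun) a y pa py := derive1 (fun t => f a t pa py) y.
Definition d_Pa (f : pfun) a y pa py := derive1 (fun t => f a y t py) pa.
Definition d_Py (f : pfun) a y pa py := derive1 (fun t => f a y pa t) py.

Definition pbracket (f g : pfun) : pfun := fun a y pa py =>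
  d_a f a y pa py * d_Pa g a y pa py - d_Pa f a y pa py * d_a g a y pa py
+ d_y f a y pa py * d_Py g a y pa py - d_Py f a y pa py * d_y g a y pa py.

Definition jac3 (f1 f2 f3 : pfun) a y pa py : 'M[R]_(3,4) :=
  \matrix_(i < 3, j < 4)
    (let f := nth f1 [:: f1; f2; f3] i in
     nth (d_a f) [:: d_a f; d_y f; d_Pa f; d_Py f] j a y pa py).

(* functional independence on the domain {a in I}: the differentials are
   linearly independent (Jacobian of rank 3) on a dense subset of the domain *)
Definition funct_indep (I : set R) (f1 f2 f3 : pfun) : Prop :=
  forall a y pa py, I a -> forall e : R, 0 < e ->
    exists a' y' pa' py', [/\ I a', `|a' - a| < e, `|y' - y| < e,
        `|pa' - pa| < e & `|py' - py| < e] /\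
      \rank (jac3 f1 f2 f3 a' y' pa' py') = 3%N.

Variable n : nat.
Variable ai : 'I_n -> R.

Definition Fpoly : {poly R} := \prod_(i < n) ('X - (ai i)%:P).
Definition Acoef (k : nat) : R := Fpoly`_k.
Definition Fpoly_i (i : 'I_n) : {poly R} :=
  \prod_(l < n | l != i) ('X - (ai l)%:P).
Definition Fpoly_ij (i j : 'I_n) : {poly R} :=
  \prod_(l < n | (l != i) && (l != j)) ('X - (ai l)%:P).

(* sigma_k, 0 <= k <= n :  prod_i (a - a_i) = sum_k (-1)^k sigma_k a^(n-k) *)
Definition sigma (k : nat) : R :=
  if (k <= n)%N then (-1) ^+ k * Fpoly`_(n - k) else 0.
Definition sigma_i (i : 'I_n) (m : int) : R :=
  match m with
  | Posz m' => if (m' <= n.-1)%N then (-1) ^+ m' * (Fpoly_i i)`_(n.-1 - m') else 0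
  | Negz _ => 0
  end.
Definition sigma_ij (i j : 'I_n) (m : int) : R :=
  match m with
  | Posz m' => if (m' <= n.-2)%N then (-1) ^+ m' * (Fpoly_ij i j)`_(n.-2 - m') else 0
  | Negz _ => 0
  end.

Variables (eps : 'I_n -> R) (xi : 'I_n -> R) (nu : R).

Definition Delta (i : 'I_n) (a : R) : R := eps i * (a - ai i).
Definition xfun (a : R) : R :=
  nu / 2 * a + \sum_(i < n) xi i / Num.sqrt (Delta i a).
Definition xdot (a : R) : R := derive1 xfun a.

Definition Pi : pfun := fun a y pa py => a / xdot a * pa.
Definition Ham : pfun := fun a y pa py => Pi a y pa py ^+ 2 + a * py ^+ 2.
Definition Py : pfun := fun a y pa py => py.

Definition btil (k : nat) (a : R) : R :=
  (-1) ^+ k * (nu * sigma k +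
    \sum_(i < n) xi i / Num.sqrt (Delta i a) * sigma_i i (k%:Z - 1)).

Definition ctil (k : nat) (a : R) : R :=
  (-1) ^+ k.+1 / 2 *
   (nu ^+ 2 * a * sigma k
    + 2 * nu * \sum_(i < n) xi i / Num.sqrt (Delta i a)
                  * (sigma_i i k%:Z + a * sigma_i i (k%:Z - 1))
    + \sum_(i < n) xi i ^+ 2 / Delta i a * sigma_i i (k%:Z - 1)
    + \sum_(i < n) \sum_(j < n | j != i)
         xi i * xi j / Num.sqrt (Delta i a * Delta j a)
           * (sigma_ij i j (k%:Z - 1) + a * sigma_ij i j (k%:Z - 2))).

Definition Gfun : pfun := fun a y pa py =>
  \sum_(k < n.+1) Acoef (n - k) * Ham a y pa py ^+ (n - k) * py ^+ (2 * k).+1.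
Definition Q1 : pfun := fun a y pa py =>
  \sum_(k < n.+1) btil k a * Ham a y pa py ^+ (n - k) * Pi a y pa py * py ^+ (2 * k).
Definition Q2 : pfun := fun a y pa py =>
  \sum_(k < n.+1) ctil k a * Ham a y pa py ^+ (n - k) * py ^+ (2 * k).+1.

Definition S1 : pfun := fun a y pa py => Q1 a y pa py + y * Gfun a y pa py.
Definition S2 : pfun := fun a y pa py =>
  Q2 a y pa py + y * Q1 a y pa py + y ^+ 2 / 2 * Gfun a y pa py.

End Defs.

(* Main.v *)
Require Import Defs.
From HB Require Import structures.
From mathcomp Require Import all_boot all_order all_algebra.
From mathcomp Require Import all_classical all_reals all_analysis.
From mathcomp Require Import zify ring lra.
Import Order.TTheory GRing.Theory Num.Theory.
Import numFieldNormedType.Exports.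
Local Open Scope ring_scope.

(** Write [u_i = xi_i / sqrt Delta_i] and let [F], [F_i], [F_ij] be the monic
polynomials with roots [a_l], omitting none, [a_i], or [a_i] and [a_j].  The
derivation [{H, .}] kills [H] and [P_y] and sends [Pi] to [(a / x') P_y^2], [y] to
[- 2 a P_y] and a function [b(a)] to [- 2 Pi (a / x') b'].  The coefficients
[btil_k] are those of [B = nu F - sum_i u_i F_i], and since
[u_i' = - u_i / (2 (a - a_i))], the partial fraction identity
[(X - a) F_i / (a - a_i) = F / (a - a_i) - F_i] gives [B - 2 (X - a) B' = 2 x' F]
(prime being d/da).  Homogenized in [H] and [P_y^2], with [Pi^2 = H - a P_y^2], this
says [{H, Q1} = 2 a P_y G].  The same identity shows that the polynomial [C] with
coefficients [ctil_k] satisfies [C' = - x' B], that is [{H, Q2} = 2 a P_y Q1].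

The differentials of [H], [P_y], [S] are independent as soon as [dH/dP_a] and [dS/dy]
do not vanish.  As [G = P_y^(2n+1) F(H / P_y^2)] is a nonzero polynomial in [P_a] for
[P_y <> 0], and [dS_1/dy = G], [dS_2/dy = Q1 + y G], this holds on a dense set. *)

(** * Differentiation rules for functions given by expressions *)

Section Derive1.
Context {R : realType}.
Implicit Types (f g : R -> R) (x : R).

Lemma derive1_add f g x : derivable f x 1 -> derivable g x 1 ->
  derive1 (fun t => f t + g t) x = derive1 f x + derive1 g x.
Proof. by move=> df dg; rewrite !derive1E; exact (deriveD df dg). Qed.

Lemma derive1_mul f g x : derivable f x 1 -> derivable g x 1 ->
  derive1 (fun t => f t * g t) x = f x * derive1 g x + g x * derive1 f x.
Proof. by move=> df dg; rewrite !derive1E; exact (deriveM df dg). Qed.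

Lemma is_derive_derive1 f x df : is_derive x 1 f df -> derive1 f x = df.
Proof. by move=> fdf; rewrite derive1E; exact: derive_val. Qed.

Lemma is_derive_add f g x df dg : is_derive x 1 f df -> is_derive x 1 g dg ->
  is_derive x 1 (fun t => f t + g t) (df + dg).
Proof. by move=> F G; exact (is_deriveD F G). Qed.

Lemma is_derive_mul f g x df dg : is_derive x 1 f df -> is_derive x 1 g dg ->
  is_derive x 1 (fun t => f t * g t) (f x * dg + df * g x).
Proof. by move=> F G; rewrite [df * _]mulrC; exact (is_deriveM F G). Qed.

Lemma is_derive_mull c f x df : is_derive x 1 f df ->
  is_derive x 1 (fun t => c * f t) (c * df).
Proof. by move=> F; exact (is_deriveZ c F). Qed.

Lemma is_derive_mulr c f x df : is_derive x 1 f df ->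
  is_derive x 1 (fun t => f t * c) (df * c).
Proof.
move=> F; rewrite mulrC; have -> : (fun t => f t * c) = (fun t => c * f t).
  by apply: funext => t; rewrite mulrC.
exact: is_derive_mull.
Qed.

Lemma is_derive_inv f x df : f x != 0 -> is_derive x 1 f df ->
  is_derive x 1 (fun t => (f t)^-1) (- df / f x ^+ 2).
Proof.
by move=> f0 F; rewrite mulNr mulrC -mulNr; exact (is_deriveV f0 F).
Qed.

Lemma is_derive_bigsum m (P : pred 'I_m) (h : 'I_m -> R -> R) x dh :
  (forall i, P i -> is_derive x 1 (h i) (dh i)) ->
  is_derive x 1 (fun t => \sum_(i < m | P i) h i t) (\sum_(i < m | P i) dh i).
Proof.
(* The condition [P] moves into the summand, as a zero function outside [P], so that the sum runs
   over all indices. *)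
move=> hd; have -> : (fun t => \sum_(i < m | P i) h i t)
    = \sum_(i < m) (fun t => if P i then h i t else 0).
  by apply: funext => t; rewrite fct_sumE big_mkcond.
rewrite [X in is_derive _ _ _ X]big_mkcond; apply: is_derive_sum => i.
by case: (boolP (P i)) => [/hd //|_]; exact: is_derive_cst.
Qed.

End Derive1.

Arguments derive1_add {R f g x}.
Arguments derive1_mul {R f g x}.
Arguments is_derive_derive1 {R f x df}.
Arguments is_derive_add {R f g x df dg}.
Arguments is_derive_mul {R f g x df dg}.
Arguments is_derive_mull {R} c {f x df}.
Arguments is_derive_mulr {R} c {f x df}.
Arguments is_derive_inv {R} f {x df}.
Arguments is_derive_bigsum {R m} P {h x dh}.

(* [ring] compares atoms up to conversion, which is very slow on derivatives. *)
Ltac ring_derive1 :=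
  repeat match goal with
  | |- context [d_a ?f ?a ?y ?pa ?py] => generalize (d_a f a y pa py)
  | |- context [d_y ?f ?a ?y ?pa ?py] => generalize (d_y f a y pa py)
  | |- context [d_Pa ?f ?a ?y ?pa ?py] => generalize (d_Pa f a y pa py)
  | |- context [d_Py ?f ?a ?y ?pa ?py] => generalize (d_Py f a y pa py)
  end; intros; ring.

(** * The Poisson bracket with [H] as a derivation *)

Section Derivation.
Context {R : realType}.
Variable H : pfun R.
Variables a y pa py : R.

Definition partially_derivable (f : pfun R) :=
  [/\ derivable (fun t : R => f t y pa py) a 1, derivable (fun t : R => f a t pa py) y 1,
      derivable (fun t : R => f a y t py) pa 1 &
      derivable (fun t : R => f a y pa t) py 1].

(** Derivability is carried along with the value, because the sum and product rules for [derive1]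
    need it. The bracket with [H] can then be computed along the shape of an expression. *)
Definition bracket_is (f : pfun R) (v : R) :=
  partially_derivable f /\ pbracket H f a y pa py = v.

Lemma bracket_is_eq f u v : bracket_is f u -> u = v -> bracket_is f v.
Proof. by move=> ? <-. Qed.

Lemma bracket_is_ext f g v : (forall a y pa py, f a y pa py = g a y pa py) ->
  bracket_is f v -> bracket_is g v.
Proof. by move=> fg; have -> // : f = g by do 4 apply: funext => ?. Qed.

Lemma bracket_isD f g u v : bracket_is f u -> bracket_is g v ->
  bracket_is (fun a y pa py => f a y pa py + g a y pa py) (u + v).
Proof.
move=> [[f1 f2 f3 f4] <-] [[g1 g2 g3 g4] <-]; split.
  by split; [exact (derivableD f1 g1)|exact (derivableD f2 g2)
             |exact (derivableD f3 g3)|exact (derivableD f4 g4)].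
set h := (fun a y pa py => f a y pa py + g a y pa py).
have e1 : d_a h a y pa py = d_a f a y pa py + d_a g a y pa py.
  exact: (derive1_add f1 g1).
have e2 : d_y h a y pa py = d_y f a y pa py + d_y g a y pa py.
  exact: (derive1_add f2 g2).
have e3 : d_Pa h a y pa py = d_Pa f a y pa py + d_Pa g a y pa py.
  exact: (derive1_add f3 g3).
have e4 : d_Py h a y pa py = d_Py f a y pa py + d_Py g a y pa py.
  exact: (derive1_add f4 g4).
rewrite /pbracket e1 e2 e3 e4; ring_derive1.
Qed.

Lemma bracket_isM f g u v : bracket_is f u -> bracket_is g v ->
  bracket_is (fun a y pa py => f a y pa py * g a y pa py)
    (f a y pa py * v + u * g a y pa py).
Proof.
move=> [[f1 f2 f3 f4] <-] [[g1 g2 g3 g4] <-]; split.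
  by split; [exact (derivableM f1 g1)|exact (derivableM f2 g2)
             |exact (derivableM f3 g3)|exact (derivableM f4 g4)].
set h := (fun a y pa py => f a y pa py * g a y pa py).
have e1 : d_a h a y pa py =
    f a y pa py * d_a g a y pa py + g a y pa py * d_a f a y pa py.
  exact: (derive1_mul f1 g1).
have e2 : d_y h a y pa py =
    f a y pa py * d_y g a y pa py + g a y pa py * d_y f a y pa py.
  exact: (derive1_mul f2 g2).
have e3 : d_Pa h a y pa py =
    f a y pa py * d_Pa g a y pa py + g a y pa py * d_Pa f a y pa py.
  exact: (derive1_mul f3 g3).
have e4 : d_Py h a y pa py =
    f a y pa py * d_Py g a y pa py + g a y pa py * d_Py f a y pa py.
  exact: (derive1_mul f4 g4).
rewrite /pbracket e1 e2 e3 e4; ring_derive1.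
Qed.

Lemma bracket_is_cst c : bracket_is (fun _ _ _ _ => c) 0.
Proof.
split; first by split; exact: derivable_cst.
(* The occurrence numbers select the four partial derivatives of the second argument; those of [H]
   stay folded as atoms. *)
by rewrite /pbracket {2}/d_a {2}/d_y {1}/d_Pa {1}/d_Py !derive1E !derive_cst; ring_derive1.
Qed.

(** Induction with the Leibniz rule. At [k = 0] the truncated exponent [k.-1] is harmless, since the
    factor [k%:R] vanishes. *)
Lemma bracket_isX f u k : bracket_is f u ->
  bracket_is (fun a y pa py => f a y pa py ^+ k)
    (k%:R * f a y pa py ^+ k.-1 * u).
Proof.
move=> fu; elim: k => [|k IH].
  by apply: (bracket_is_eq _ _ _ (bracket_is_cst 1)); rewrite !mul0r.
apply: (bracket_is_ext _ _ _ (fun _ _ _ _ => esym (exprS _ _))).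
apply: (bracket_is_eq _ _ _ (bracket_isM f _ _ _ fu IH)).
by case: k {IH} => [|k]; rewrite ?expr0 ?mul0r /= ?exprS -?natr1; ring.
Qed.

Lemma bracket_is_sum m (f : 'I_m -> pfun R) u :
  (forall i, bracket_is (f i) (u i)) ->
  bracket_is (fun a y pa py => \sum_i f i a y pa py) (\sum_i u i).
Proof.
elim: m f u => [|m IH] f u fu.
  rewrite big_ord0; apply: (bracket_is_ext (fun _ _ _ _ => 0)) => [*|].
    by rewrite big_ord0.
  exact: bracket_is_cst.
rewrite big_ord_recl.
apply: (bracket_is_ext
  (fun a y pa py => f ord0 a y pa py + \sum_i f (lift ord0 i) a y pa py)) => [*|].
  by rewrite big_ord_recl.
by apply: bracket_isD => //; apply: IH.
Qed.

Lemma bracket_is_base (b : R -> R) db : is_derive a 1 b db ->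
  bracket_is (fun a _ _ _ => b a) (- d_Pa H a y pa py * db).
Proof.
move=> b_db; split; first by split; [exact: ex_derive|exact: derivable_cst..].
rewrite /pbracket {2}/d_a {2}/d_y {1}/d_Pa {1}/d_Py !derive1E !derive_cst derive_val.
ring_derive1.
Qed.

Lemma bracket_is_y : bracket_is (fun _ y _ _ => y) (- d_Py H a y pa py).
Proof.
split; first by split; [exact: derivable_cst|exact: derivable_id|exact: derivable_cst..].
rewrite /pbracket {2}/d_a {2}/d_y {1}/d_Pa {1}/d_Py !derive1E !derive_cst derive_id.
ring_derive1.
Qed.

Lemma bracket_is_Pa : bracket_is (fun _ _ pa _ => pa) (d_a H a y pa py).
Proof.
split; first by split; [exact: derivable_cst..|exact: derivable_id|exact: derivable_cst].
rewrite /pbracket {2}/d_a {2}/d_y {1}/d_Pa {1}/d_Py !derive1E !derive_cst derive_id.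
ring_derive1.
Qed.

Lemma bracket_is_Py : bracket_is (@Py R) (d_y H a y pa py).
Proof.
split; first by split; [exact: derivable_cst..|exact: derivable_id].
rewrite /pbracket {2}/d_a {2}/d_y {1}/d_Pa {1}/d_Py !derive1E !derive_cst derive_id.
ring_derive1.
Qed.

Lemma bracket_is_self : partially_derivable H -> bracket_is H 0.
Proof. by move=> Hd; split=> //; rewrite /pbracket; ring_derive1. Qed.

End Derivation.

Arguments bracket_is_eq {R H a y pa py f u v}.
Arguments bracket_is_ext {R H a y pa py} f {g v}.
Arguments bracket_isD {R H a y pa py f g u v}.
Arguments bracket_isM {R H a y pa py f g u v}.
Arguments bracket_isX {R H a y pa py f u} k.

(** * Derivatives of the functions of [a] alone: [u_i], [x] and [x'] *)

Section Base.
Context {R : realType} {n : nat}.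
Variables (ai eps xi : 'I_n -> R) (nu : R).
Hypothesis eps_neq0 : forall i, eps i != 0.

Definition uterm (i : 'I_n) (t : R) : R := xi i / Num.sqrt (Delta ai eps i t).

Lemma Delta_neq0 i t : 0 < Delta ai eps i t -> t - ai i != 0.
Proof. by move=> /lt0r_neq0; rewrite mulf_eq0 negb_or => /andP[]. Qed.

Lemma is_derive_subr (c t : R) : is_derive t 1 (fun s => s - c) 1.
Proof.
rewrite -[X in is_derive _ _ _ X](addr0 1).
exact: (is_derive_add (is_derive_id t 1) (is_derive_cst (- c) t 1)).
Qed.

Lemma is_derive_Delta (i : 'I_n) (t : R) :
  is_derive t 1 (Delta ai eps i) (eps i).
Proof.
rewrite -[X in is_derive _ _ _ X](mulr1 (eps i)).
exact: (is_derive_mull _ (is_derive_subr _ _)).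
Qed.

(** The chain rule gives [- xi_i eps_i / (2 Delta_i sqrt Delta_i)]; as [Delta_i = eps_i (t - a_i)],
    the factor [eps_i] cancels. *)
Lemma is_derive_uterm (i : 'I_n) (t : R) : 0 < Delta ai eps i t ->
  is_derive t 1 (uterm i) (- (uterm i t / (t - ai i)) / 2).
Proof.
move=> D0; have Dt := is_derive_Delta i t.
have s0 : Num.sqrt (Delta ai eps i t) != 0 by rewrite gt_eqF ?sqrtr_gt0.
have dcomp := is_derive1_comp (is_derive1_sqrt D0) Dt.
have du := is_derive_mull (xi i) (is_derive_inv (Num.sqrt \o _) s0 dcomp).
apply: (is_derive_eq du).
have e : Num.sqrt (Delta ai eps i t) ^+ 2 = eps i * (t - ai i).
  by rewrite sqr_sqrtr ?ltW.
have := Delta_neq0 _ _ D0; have := eps_neq0 i.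
rewrite /= e /uterm; move: s0; set s := Num.sqrt _; move: (t - ai i) => d s0 e0 d0.
by field; rewrite s0 e0 d0.
Qed.

Lemma is_derive_xfun t : (forall i, 0 < Delta ai eps i t) ->
  is_derive t 1 (xfun ai eps xi nu)
    ((nu - \sum_(i < n) uterm i t / (t - ai i)) / 2).
Proof.
move=> D0.
have d1 := is_derive_mull (nu / 2) (is_derive_id t (1 : R)).
have d2 := is_derive_bigsum predT (fun i _ => is_derive_uterm i t (D0 i)).
apply: (is_derive_eq (is_derive_add d1 d2)).
by rewrite mulr1 mulrBl -mulr_suml sumrN mulNr.
Qed.

Lemma xdotE t : (forall i, 0 < Delta ai eps i t) ->
  xdot ai eps xi nu t = (nu - \sum_(i < n) uterm i t / (t - ai i)) / 2.
Proof. by move=> D0; apply: is_derive_derive1; exact: is_derive_xfun. Qed.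

(** The closed formula for [x'] holds only where all [Delta_i] are positive, so positivity is
    required on a neighbourhood of [a] and not just at [a]. *)
Lemma derivable_xdot (a : R) : (\forall t \near a, forall i, 0 < Delta ai eps i t) ->
  derivable (xdot ai eps xi nu) a 1.
Proof.
move=> Dnear; have D0 : forall i, 0 < Delta ai eps i a := nbhs_singleton Dnear.
apply: (@near_eq_derivable _ _ _
  (fun t => (nu + -1 * \sum_(i < n) uterm i t * (t - ai i)^-1) * 2^-1)).
  near=> t; rewrite xdotE ?mulN1r //.
  by near: t.
have dsum := is_derive_bigsum predT (fun i _ =>
  is_derive_mul (is_derive_uterm i a (D0 i))
    (is_derive_inv (fun t => t - ai i) (Delta_neq0 _ _ (D0 i)) (is_derive_subr _ a))).
have d := is_derive_mulr 2^-1 (is_derive_add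
  (is_derive_cst nu a 1) (is_derive_mull (-1) dsum)).
exact: (@ex_derive _ _ _ _ _ _ _ d).
Unshelve. all: by end_near. Qed.

End Base.

(** * Brackets of [H] with the building blocks of the integrals *)

Section HamiltonianFlow.
Context {R : realType} {n : nat}.
Variables (ai eps xi : 'I_n -> R) (nu : R).
Variables a y pa py : R.
Hypothesis eps_neq0 : forall i, eps i != 0.
Hypothesis Dnear : \forall t \near a, forall i, 0 < Delta ai eps i t.
Hypothesis xdot_neq0 : xdot ai eps xi nu a != 0.

Let H := Ham ai eps xi nu.
Let m (t : R) := t / xdot ai eps xi nu t.
Let pi0 : R := m a * pa.

Lemma is_derive_metric : is_derive a 1 m (derive1 m a).
Proof.
have dx := derivableP (derivable_xdot ai eps xi nu eps_neq0 a Dnear).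
have dm := is_derive_mul (is_derive_id a (1 : R))
             (is_derive_inv _ xdot_neq0 dx).
apply: (is_derive_eq dm); apply/esym.
exact: (is_derive_derive1 (f := m) dm).
Qed.

Lemma d_a_Ham : d_a H a y pa py = 2 * pi0 * derive1 m a * pa + py ^+ 2.
Proof.
have dp := is_derive_mulr pa is_derive_metric.
have dH := is_derive_add (is_derive_mul dp dp)
   (is_derive_mulr (py ^+ 2) (is_derive_id a (1 : R))).
transitivity (pi0 * (derive1 m a * pa) + derive1 m a * pa * pi0 + 1 * py ^+ 2);
  last by move: (derive1 m a) pi0 => *; ring.
by rewrite /d_a; exact: (is_derive_derive1 dH).
Qed.

Lemma d_y_Ham : d_y H a y pa py = 0.
Proof. exact: (is_derive_derive1 (is_derive_cst (H a y pa py) y 1)). Qed.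

Lemma d_Pa_Ham : d_Pa H a y pa py = 2 * pi0 * m a.
Proof.
have dp := is_derive_mull (m a) (is_derive_id pa (1 : R)).
have dH := is_derive_add (is_derive_mul dp dp)
   (is_derive_cst (a * py ^+ 2) pa 1).
transitivity (pi0 * (m a * 1) + m a * 1 * pi0 + 0); last ring.
by rewrite /d_Pa; exact: (is_derive_derive1 dH).
Qed.

Lemma d_Py_Ham : d_Py H a y pa py = 2 * a * py.
Proof.
have dp := is_derive_id py (1 : R).
have dH := is_derive_add (is_derive_cst (pi0 ^+ 2) py 1)
   (is_derive_mull a (is_derive_mul dp dp)).
transitivity (0 + a * (py * 1 + 1 * py)); last ring.
by rewrite /d_Py; exact: (is_derive_derive1 dH).
Qed.

Local Notation flow := (bracket_is H a y pa py).

Lemma flow_Py : flow (@Py R) 0.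
Proof. rewrite -d_y_Ham; exact: bracket_is_Py. Qed.

Lemma flow_y : flow (fun _ y _ _ => y) (- (2 * a * py)).
Proof. rewrite -d_Py_Ham; exact: bracket_is_y. Qed.

Lemma flow_base b db : is_derive a 1 b db ->
  flow (fun a _ _ _ => b a) (- (2 * pi0 * m a * db)).
Proof. by move=> bd; rewrite -d_Pa_Ham -mulNr; exact: bracket_is_base. Qed.

(** The derivative of [m = a / x'] enters once through [{H, m}] and once through [d_a H], with
    opposite signs; hence no explicit value of it is ever computed. *)
Lemma flow_Pi : flow (Pi ai eps xi nu) (m a * py ^+ 2).
Proof.
apply: (bracket_is_eq
  (bracket_isM (flow_base _ _ is_derive_metric)
     (bracket_is_Pa H a y pa py))).
by rewrite d_a_Ham /pi0; move: (derive1 m a) (m a) => *; ring.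
Qed.

Lemma flow_Ham : flow H 0.
Proof.
(* Antisymmetry gives the value 0; the Leibniz computation below serves only for the partial
   derivability of [H]. *)
apply: bracket_is_self; suff [] : flow H (2 * pi0 * (m a * py ^+ 2)
    - 2 * pi0 * m a * py ^+ 2) by [].
have fa := flow_base _ _ (is_derive_id a (1 : R)).
apply: (bracket_is_eq
  (bracket_isD (bracket_isX 2 flow_Pi)
     (bracket_isM fa (bracket_isX 2 flow_Py)))).
by rewrite /Pi /Py -/(m a) -/pi0 /=; move: (m a) pi0 => *; ring.
Qed.

(** The common shape of the three sums: [G], [Q1] and [Q2] are [Py], [Pi] and [Py] times such a
    sum. *)
Definition homsum (c : nat -> R -> R) : pfun R := fun a y pa py =>
  \sum_(k < n.+1) c k a * H a y pa py ^+ (n - k) * py ^+ (2 * k).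

(** [H] and [Py] are conserved, so only the coefficients contribute to the bracket. *)
Lemma flow_homsum c dc : (forall k, (k <= n)%N -> is_derive a 1 (c k) (dc k)) ->
  flow (homsum c) (- (2 * pi0 * m a) *
    \sum_(k < n.+1) dc k * H a y pa py ^+ (n - k) * py ^+ (2 * k)).
Proof.
move=> cdc; rewrite mulr_sumr; apply: bracket_is_sum => k.
have /cdc/flow_base fc : (k <= n)%N by rewrite -ltnS.
apply: (bracket_is_eq (bracket_isM
  (bracket_isM fc (bracket_isX (n - k) flow_Ham))
  (bracket_isX (2 * k) flow_Py))).
rewrite /Py; move: (_ ^+ (2 * k)) (_ ^+ (n - k)) (_ ^+ (_.-1)) (_ ^+ (_.-1)).
by move: (m a) pi0 => *; ring.
Qed.

End HamiltonianFlow.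

(** * Symmetric functions as coefficients of the root polynomials *)

Section RootPolynomials.
Context {R : realType} {n : nat}.
Variable ai : 'I_n -> R.
Local Notation F := (Fpoly ai).
Local Notation Fi := (Fpoly_i ai).
Local Notation Fij := (Fpoly_ij ai).

Lemma Fpoly_mul i : F = ('X - (ai i)%:P) * Fi i.
Proof. by rewrite /Fpoly (bigD1 i). Qed.

Lemma Fpoly_i_mul i j : j != i -> Fi i = ('X - (ai j)%:P) * Fij i j.
Proof. by move=> ji; rewrite /Fpoly_i (bigD1 j). Qed.

Lemma Fpoly_ijC i j : Fij i j = Fij j i.
Proof. by apply: eq_bigl => l; rewrite andbC. Qed.

Lemma size_Fpoly : size F = n.+1.
Proof. by rewrite size_prod_XsubC /index_enum -enumT size_enum_ord. Qed.

Lemma size_Fpoly_i i : size (Fi i) = n.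
Proof.
have := size_Fpoly; rewrite (Fpoly_mul i) size_monicM ?monicXsubC //.
  by rewrite size_XsubC => -[].
by rewrite monic_neq0 // monic_prod_XsubC.
Qed.

Lemma size_Fpoly_ij i j : j != i -> (size (Fij i j)).+1 = n.
Proof.
move=> ji; have := size_Fpoly_i i; rewrite (Fpoly_i_mul _ _ ji).
rewrite size_monicM ?monicXsubC //; last by rewrite monic_neq0 // monic_prod_XsubC.
by rewrite size_XsubC.
Qed.

Lemma sigma_coef k : (k <= n)%N -> (-1) ^+ k * sigma ai k = F`_(n - k).
Proof. by move=> kn; rewrite /sigma kn mulrA -expr2 sqrr_sign mul1r. Qed.

(** All coefficients are read in degree [n - k], and the factor ['X] makes up for the degree [n - 1]
    of [F_i]. At [k = n] both sides are 0. *)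
Lemma sigma_i_coef i k : (k <= n)%N ->
  (-1) ^+ k * sigma_i ai i k%:Z = ('X * Fi i)`_(n - k).
Proof.
move=> kn; have n0 : (0 < n)%N by rewrite (leq_ltn_trans _ (ltn_ord i)).
rewrite /sigma_i coefXM -[X in (_ <= X)%N]subn1 leq_subRL // add1n subn_eq0.
rewrite [(n <= k)%N]leqNgt; case: ifP => _ /=; last by rewrite mulr0.
rewrite mulrA -expr2 sqrr_sign mul1r; congr (_`_ _); lia.
Qed.

(** The sign comes from the shift of [k] by one. At [k = 0] both sides are 0, as [F_i] has no term
    of degree [n]. *)
Lemma sigma_i_coef1 i k : (k <= n)%N ->
  (-1) ^+ k * sigma_i ai i (k%:Z - 1) = - (Fi i)`_(n - k).
Proof.
case: k => [_|k kn].
  by rewrite subn0 nth_default ?size_Fpoly_i // oppr0 mulr0.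
rewrite (_ : k.+1%:Z - 1 = k%:Z); last lia.
rewrite exprS -mulrA sigma_i_coef 1?ltnW // coefXM subn_eq0 leqNgt kn /=.
by rewrite mulN1r subnS.
Qed.

Lemma sigma_ij_coef1 i j k : j != i -> (k <= n)%N ->
  (-1) ^+ k * sigma_ij ai i j (k%:Z - 1) = - ('X * Fij i j)`_(n - k).
Proof.
have := ltn_ord i; have := ltn_ord j => jn lin ji.
(* Two distinct indices force [n] to be at least 2, so [n.-2] is a genuine subtraction. *)
have n1 : (1 < n)%N by move: ji; rewrite -val_eqE /=; lia.
have := size_Fpoly_ij _ _ ji; set s := size _ => sF; rewrite coefXM.
case: k => [_|k kn].
  by rewrite subn0 nth_default ?if_same ?oppr0 ?mulr0 // -/s; lia.
rewrite (_ : k.+1%:Z - 1 = k%:Z); last lia.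
rewrite /sigma_ij; case: ifPn => kn2.
  have -> : (n - k.+1 == 0)%N = false by lia.
  rewrite exprS mulrA -[-1 * _ * _]mulrA -expr2 sqrr_sign mulr1 mulN1r.
  by congr (- _`_ _); lia.
case: ifPn => kn1; first by rewrite mulr0 oppr0.
lia.
Qed.

Lemma sigma_ij_coef2 i j k : j != i -> (k <= n)%N ->
  (-1) ^+ k * sigma_ij ai i j (k%:Z - 2) = (Fij i j)`_(n - k).
Proof.
have := ltn_ord i; have := ltn_ord j => jn lin ji.
have n1 : (1 < n)%N by move: ji; rewrite -val_eqE /=; lia.
have := size_Fpoly_ij _ _ ji; set s := size _ => sF.
case: k => [|[|k]] kn.
- by rewrite subn0 nth_default ?mulr0 // -/s; lia.
- by rewrite nth_default ?mulr0 // -/s; lia.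
rewrite (_ : k.+2%:Z - 2 = k%:Z); last lia.
rewrite /sigma_ij; have -> : (k <= n.-2)%N by lia.
rewrite 2!exprS !mulrA mulrNN mulr1 mul1r -expr2 sqrr_sign mul1r.
by congr (_`_ _); lia.
Qed.

End RootPolynomials.

(** * Partial fraction identities behind the two derivative formulas *)

Section PolynomialIdentities.
Context {R : realType} {n : nat}.
Variables (ai : 'I_n -> R) (nu a : R) (u w : 'I_n -> R).
Hypothesis uE : forall i, u i = w i * (a - ai i).
Local Notation F := (Fpoly ai).
Local Notation Fi := (Fpoly_i ai).
Local Notation Fij := (Fpoly_ij ai).
Local Notation T := ('X - a%:P).
Local Notation W := (\sum_i w i).

Lemma polyC_pole i : (u i)%:P = (w i)%:P * (a%:P - (ai i)%:P).
Proof. by rewrite -polyCB -polyCM -uE. Qed.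

Lemma polyC_W : W%:P = \sum_i (w i)%:P.
Proof. exact: (rmorph_sum (@polyC R)). Qed.

Definition Bpoly := nu%:P * F - \sum_i (u i)%:P * Fi i.

(** Termwise, [u_i = w_i (a - a_i)] gives [u_i F_i + (X - a) w_i F_i = w_i (X - a_i) F_i = w_i
    F]. *)
Lemma Bpoly_ode :
  Bpoly - T * \sum_i (w i)%:P * Fi i = (nu - W)%:P * F.
Proof.
rewrite /Bpoly polyCB polyC_W [RHS]mulrBl mulr_suml mulr_sumr -addrA -opprD -big_split /=.
congr (_ - _); apply: eq_bigr => i _.
by rewrite polyC_pole (Fpoly_mul ai i); ring.
Qed.

(** This is [- 2 C'], where [C] has the coefficients [ctil] and the derivative in [a] is written out
    with [u_i' = - w_i / 2]. *)
Definition Dpoly :=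
  (nu ^+ 2)%:P * F
  - nu%:P * \sum_i ((w i)%:P * (T * Fi i) + (2 * u i)%:P * Fi i)
  + \sum_i (u i * w i)%:P * Fi i
  + \sum_i \sum_(j | j != i) (((u i * w j + w i * u j) / 2)%:P * (T * Fij i j)
                              + (u i * u j)%:P * Fij i j).

(** As [nu - W] is [2 x'], this amounts to [C' = - x' B]. *)
Lemma DpolyE : Dpoly = (nu - W)%:P * Bpoly.
Proof.
have -> : Dpoly = (nu ^+ 2)%:P * F
    - nu%:P * \sum_i ((w i)%:P * F + (u i)%:P * Fi i)
    + (\sum_i (u i * w i)%:P * Fi i + \sum_i \sum_(j | j != i) (u i * w j)%:P * Fi i).
  rewrite /Dpoly -!addrA; congr (_ + (- (_ * _) + (_ + _))).
    apply: eq_bigr => i _; rewrite polyCM polyC_pole (Fpoly_mul ai i).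
    by rewrite (_ : 2%:P = 2) ?polyC_natr //; ring.
  (* Writing [u_i u_j] as half the sum of [u_i w_j (a - a_j)] and [w_i u_j (a - a_i)] turns each
     double-sum term into [f i j + f j i]; exchanging the indices then merges the two sums. *)
  pose f i j := (2^-1 : R)%:P * ((u i * w j)%:P * Fi i).
  transitivity (\sum_i \sum_(j | j != i) f i j + \sum_i \sum_(j | j != i) f j i).
    rewrite -big_split /=; apply: eq_bigr => i _; rewrite -big_split /=.
    apply: eq_bigr => j ji; rewrite /f.
    rewrite (Fpoly_i_mul ai j i) 1?eq_sym // [Fij j i]Fpoly_ijC.
    rewrite (Fpoly_i_mul ai i j) //.
    rewrite (_ : (u i * u j)%:P = 2^-1%:P * (2%:P * (u i * u j)%:P)); last first.
      by rewrite mulrA -[2^-1%:P * _]polyCM mulVf ?pnatr_eq0 // mul1r.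
    rewrite (_ : 2%:P = 2) ?polyC_natr // mulrC -mulrA.
    rewrite !polyCM !polyCD !polyCM (polyC_pole i) (polyC_pole j).
    by move: (w i)%:P (w j)%:P (ai i)%:P (ai j)%:P => *; ring.
  rewrite [X in _ + X](exchange_big_dep predT) //=.
  rewrite [X in _ + X](eq_bigr (fun i => \sum_(j | j != i) f i j)); last first.
    by move=> i _; apply: eq_bigl => j; rewrite eq_sym.
  rewrite -big_split; apply: eq_bigr => i _; rewrite -big_split.
  apply: eq_bigr => j _; rewrite /f /= -mulrDl -polyCD.
  by rewrite (_ : 2^-1 + 2^-1 = 1 :> R) ?mul1r //; lra.
(* The diagonal terms [u_i w_i] supply the missing index [j = i], so that the sum over [j] becomes
   [W]. *)
rewrite -big_split /= [X in _ + X](eq_bigr (fun i => W%:P * ((u i)%:P * Fi i))); last first.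
  move=> i _; have -> : \sum_(j | j != i) (u i * w j)%:P * Fi i
      = (u i)%:P * (\sum_(j | j != i) w j)%:P * Fi i.
    rewrite (rmorph_sum (@polyC R)) mulr_sumr mulr_suml.
    by apply: eq_bigr => j _; rewrite polyCM.
  by rewrite (bigD1 i (P := predT)) //= polyCM polyCD; ring.
rewrite -mulr_sumr big_split /= -mulr_suml -polyC_W /Bpoly.
by rewrite polyCB expr2 polyCM; ring.
Qed.

End PolynomialIdentities.

(** * Homogenization of a polynomial in [h] and [q^2] *)

Section Homogenization.
Context {R : realType} (n : nat) (h q : R).

Implicit Types p r : {poly R}.

(** For [p] of degree at most [n] and [q] nonzero this is [q^(2n) p(h / q^2)]; the sum also makes
    sense at [q = 0]. Coefficients above degree [n] are dropped. *)
Definition hom (p : {poly R}) : R :=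
  \sum_(k < n.+1) p`_(n - k) * h ^+ (n - k) * q ^+ (2 * k).

Lemma homD p r : hom (p + r) = hom p + hom r.
Proof. by rewrite -big_split; apply: eq_bigr => k _; rewrite coefD !mulrDl. Qed.

Lemma homCM c p : hom (c%:P * p) = c * hom p.
Proof. by rewrite mulr_sumr; apply: eq_bigr => k _; rewrite coefCM !mulrA. Qed.

(** The two sums differ by a shift of [k]: the last term on the left vanishes because ['X * p] has
    no constant term, the first on the right because of the bound on the size. *)
Lemma homXM p : (size p <= n)%N -> q ^+ 2 * hom ('X * p) = h * hom p.
Proof.
move=> sp; rewrite /hom big_ord_recr /= subnn coefXM !mul0r addr0.
rewrite [in RHS]big_ord_recl /= subn0 nth_default // !mul0r add0r !mulr_sumr.
apply: eq_bigr => k _; rewrite /bump leq0n add1n coefXM subn_eq0 leqNgt ltn_ord /=.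
rewrite -subnS mulnS exprD; have -> : h ^+ (n - k) = h * h ^+ (n - k.+1).
  by rewrite -exprS subnSK.
by move: (_ ^+ (n - k.+1)) (q ^+ (2 * k)) => *; ring.
Qed.

Lemma hom_horner p : (size p <= n.+1)%N -> q != 0 ->
  hom p = q ^+ (2 * n) * p.[h / q ^+ 2].
Proof.
move=> sp q0; rewrite (horner_coef_wide _ sp) /hom [in LHS](reindex_inj rev_ord_inj) /=.
rewrite mulr_sumr; apply: eq_bigr => k _; rewrite subSS.
have kn : (k <= n)%N by rewrite -ltnS.
rewrite subKn // expr_div_n -exprM.
have -> : q ^+ (2 * n) = q ^+ (2 * k) * q ^+ (2 * (n - k)).
  by rewrite -exprD -mulnDr subnKC.
by field; rewrite expf_neq0.
Qed.

End Homogenization.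

(** * The coefficients [btil] and [ctil] and their derivatives *)

Section CoefficientFunctions.
Context {R : realType} {n : nat}.
Variables (ai eps xi : 'I_n -> R) (nu a : R).
Hypothesis eps_neq0 : forall i, eps i != 0.
Hypothesis Dnear : \forall t \near a, forall i, 0 < Delta ai eps i t.
Local Notation F := (Fpoly ai).
Local Notation Fi := (Fpoly_i ai).
Local Notation Fij := (Fpoly_ij ai).
Local Notation u := (uterm ai eps xi).
Let w i := u i a / (a - ai i).
Local Notation B := (Bpoly ai nu (u ^~ a)).

Let D0 : forall i, 0 < Delta ai eps i a := nbhs_singleton Dnear.

Lemma uterm_pole i : u i a = w i * (a - ai i).
Proof. by rewrite /w divfK // (Delta_neq0 ai eps i a (D0 i)). Qed.

Lemma btilE k t : (k <= n)%N ->
  btil ai eps xi nu k t = nu * F`_(n - k) + -1 * \sum_i u i t * (Fi i)`_(n - k).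
Proof.
move=> kn; rewrite /btil mulrDr mulrCA sigma_coef // !mulr_sumr; congr (_ + _).
by apply: eq_bigr => i _; rewrite mulrCA sigma_i_coef1 // mulN1r mulrN.
Qed.

Lemma btil_coef k : (k <= n)%N -> btil ai eps xi nu k a = B`_(n - k).
Proof.
move=> kn; rewrite btilE // /Bpoly coefB coefCM coef_sum mulN1r.
by congr (_ - _); apply: eq_bigr => i _; rewrite coefCM.
Qed.

Lemma is_derive_btil k : (k <= n)%N ->
  is_derive a 1 (btil ai eps xi nu k)
    ((\sum_i (w i)%:P * Fi i)`_(n - k) / 2).
Proof.
move=> kn; have -> := funext (fun t => btilE k t kn).
have dsum := is_derive_bigsum predT (fun i _ =>
  is_derive_mulr (Fi i)`_(n - k)
    (is_derive_uterm ai eps xi eps_neq0 i a (D0 i))).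
apply: (is_derive_eq (is_derive_add
  (is_derive_cst (nu * F`_(n - k)) a 1) (is_derive_mull (-1) dsum))).
rewrite add0r mulr_sumr coef_sum mulr_suml; apply: eq_bigr => i _.
by rewrite coefCM -/(w i); move: (w i) => c; field.
Qed.

(** Rewriting [1 / Delta_i] and [1 / sqrt (Delta_i Delta_j)] as products of inverse roots needs
    positivity at [t]. The result is built from [u_i] and affine functions of [t], ready for
    differentiation. *)
Lemma ctilE k t : (k <= n)%N -> (forall i, 0 < Delta ai eps i t) ->
  ctil ai eps xi nu k t = - 2^-1 * (nu ^+ 2 * F`_(n - k) * t
   + 2 * nu * (\sum_i u i t * (('X * Fi i)`_(n - k) + (- (Fi i)`_(n - k)) * t))
   + -1 * (\sum_i u i t * u i t * (Fi i)`_(n - k))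
   + -1 * (\sum_i \sum_(j | j != i) u i t * u j t *
        (('X * Fij i j)`_(n - k) + (- (Fij i j)`_(n - k)) * t))).
Proof.
move=> kn D0t; rewrite /ctil.
have -> : (-1) ^+ k.+1 / 2 = - 2^-1 * (-1) ^+ k :> R by rewrite exprS; ring.
rewrite -[LHS]mulrA; congr (_ * _); rewrite !mulrDr; congr (_ + _ + _ + _).
- by rewrite -sigma_coef //; ring.
- rewrite mulrCA; congr (_ * _); rewrite mulr_sumr; apply: eq_bigr => i _.
  by rewrite -sigma_i_coef // -sigma_i_coef1 // /uterm; ring.
- rewrite !mulr_sumr; apply: eq_bigr => i _.
  rewrite mulrCA sigma_i_coef1 // mulrN mulN1r; congr (- (_ * _)).
  by rewrite /uterm -expr2 expr_div_n sqr_sqrtr ?ltW.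
rewrite !mulr_sumr; apply: eq_bigr => i _; rewrite !mulr_sumr; apply: eq_bigr => j ji.
rewrite -[('X * _)`_ _]opprK -sigma_ij_coef1 // -sigma_ij_coef2 //.
by rewrite /uterm sqrtrM ?ltW // invfM; ring.
Qed.

Lemma is_derive_ctil k : (k <= n)%N ->
  is_derive a 1 (ctil ai eps xi nu k) (- xdot ai eps xi nu a * B`_(n - k)).
Proof.
move=> kn; have du i := is_derive_uterm ai eps xi eps_neq0 i a (D0 i).
have daff (c d : R) : is_derive a 1 (fun t => c + d * t) d.
  apply: (is_derive_eq (is_derive_add (is_derive_cst c a 1)
    (is_derive_mull d (is_derive_id a (1 : R))))).
  by rewrite mulr1 add0r.
have d1 := is_derive_mull (nu ^+ 2 * F`_(n - k)) (is_derive_id a (1 : R)).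
have d2 := is_derive_mull (2 * nu) (is_derive_bigsum predT (fun i _ =>
  is_derive_mul (du i) (daff ('X * Fi i)`_(n - k) (- (Fi i)`_(n - k))))).
have d3 := is_derive_mull (-1) (is_derive_bigsum predT (fun i _ =>
  is_derive_mulr (Fi i)`_(n - k) (is_derive_mul (du i) (du i)))).
have d4 := is_derive_mull (-1) (is_derive_bigsum predT (fun i _ =>
  is_derive_bigsum (fun j => j != i) (fun j _ =>
  is_derive_mul (is_derive_mul (du i) (du j))
   (daff ('X * Fij i j)`_(n - k) (- (Fij i j)`_(n - k)))))).
have d := is_derive_mull (- 2^-1) (is_derive_add (is_derive_add
  (is_derive_add d1 d2) d3) d4).
(* The expanded formula agrees with [ctil] only near [a], which suffices for the derivative at
   [a]. *)
have dc := @near_eq_is_derive _ _ _ _ (ctil ai eps xi nu k) _ _ _ _ d.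
apply: (is_derive_eq (dc _)).
  by near=> t; rewrite ctilE //; near: t.
transitivity (- 2^-1 * (Dpoly ai nu a (u ^~ a) w)`_(n - k)); last first.
  rewrite (DpolyE _ _ _ _ _ uterm_pole) coefCM xdotE // /w.
  by move: (_ - _) => c; field.
congr (_ * _); rewrite /Dpoly !coefD coefN !coefCM !coef_sum.
have coefT (p : {poly R}) :
    (('X - a%:P) * p)`_(n - k) = ('X * p)`_(n - k) - a * p`_(n - k).
  by rewrite mulrBl coefB coefCM.
congr (_ + _ + _ + _).
- by rewrite mulr1.
- rewrite [2 * nu]mulrC -mulrA -mulrN; congr (_ * _).
  rewrite mulr_sumr -sumrN; apply: eq_bigr => i _.
  by rewrite coefD !coefCM coefT -/(w i); field.
- rewrite mulr_sumr; apply: eq_bigr => i _.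
  by rewrite coefCM -/(w i); field.
rewrite mulr_sumr; apply: eq_bigr => i _; rewrite coef_sum mulr_sumr.
apply: eq_bigr => j ji; rewrite coefD !coefCM coefT -/(w i) -/(w j).
by field.
Unshelve. all: by end_near. Qed.

End CoefficientFunctions.

(** * Conservation of [S1] and [S2] *)

Section Conservation.
Context {R : realType} {n : nat}.
Variables (ai eps xi : 'I_n -> R) (nu : R).
Variables a y pa py : R.
Hypothesis eps_neq0 : forall i, eps i != 0.
Hypothesis Dnear : \forall t \near a, forall i, 0 < Delta ai eps i t.
Hypothesis xdot_neq0 : xdot ai eps xi nu a != 0.

Let H := Ham ai eps xi nu.
Let h := H a y pa py.
Let m := a / xdot ai eps xi nu a.
Let pi0 : R := m * pa.
Local Notation flow := (bracket_is H a y pa py).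
Local Notation F := (Fpoly ai).
Local Notation u := (uterm ai eps xi).
Let B := Bpoly ai nu (u ^~ a).
Let D := \sum_i (u i a / (a - ai i))%:P * Fpoly_i ai i.
Local Notation hom := (hom n h py).

Let D0 : forall i, 0 < Delta ai eps i a := nbhs_singleton Dnear.

Lemma GfunE a' y' pa' py' : Gfun ai eps xi nu a' y' pa' py'
  = py' * homsum ai eps xi nu (fun k _ => Acoef ai (n - k)) a' y' pa' py'.
Proof. by rewrite mulr_sumr; apply: eq_bigr => k _; rewrite exprS; ring. Qed.

Lemma Q1E a' y' pa' py' : Q1 ai eps xi nu a' y' pa' py'
  = Pi ai eps xi nu a' y' pa' py' * homsum ai eps xi nu (btil ai eps xi nu) a' y' pa' py'.
Proof. by rewrite mulr_sumr; apply: eq_bigr => k _; ring. Qed.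

Lemma Q2E a' y' pa' py' : Q2 ai eps xi nu a' y' pa' py'
  = py' * homsum ai eps xi nu (ctil ai eps xi nu) a' y' pa' py'.
Proof. by rewrite mulr_sumr; apply: eq_bigr => k _; rewrite exprS; ring. Qed.

Lemma homsum_btil : homsum ai eps xi nu (btil ai eps xi nu) a y pa py = hom B.
Proof. by apply: eq_bigr => k _; rewrite btil_coef // -ltnS. Qed.

(** Homogenized form of [Bpoly_ode], with [D = 2 B']: after multiplication by [py^2], the factor
    [X - a] becomes [h - a py^2 = pi0^2]. *)
Lemma hom_ode : py ^+ 2 * hom B
  = pi0 ^+ 2 * hom D + 2 * xdot ai eps xi nu a * py ^+ 2 * hom F.
Proof.
have sD : (size D <= n)%N.
  apply: (leq_trans (size_sum _ _ _)); apply/bigmax_leqP => i _.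
  by rewrite mul_polyC (leq_trans (size_scale_leq _ _)) // size_Fpoly_i.
have -> : B = ('X * D + (- a)%:P * D) + (2 * xdot ai eps xi nu a)%:P * F.
  rewrite -mulrDl polyCN xdotE // mulrCA divff ?pnatr_eq0 // mulr1.
  rewrite -(Bpoly_ode ai nu a (u ^~ a)); first by rewrite addrC subrK.
  exact: uterm_pole.
rewrite !homD !homCM mulrDr mulrDr homXM //.
rewrite {1}/h /H /Ham /Pi -/m -/pi0; ring.
Qed.

Lemma flow_G : flow (Gfun ai eps xi nu) 0.
Proof.
apply: (bracket_is_ext _ (fun _ _ _ _ => esym (GfunE _ _ _ _))).
have fA := flow_homsum ai eps xi nu a y pa py eps_neq0 Dnear xdot_neq0
  (fun k _ => Acoef ai (n - k)) (fun=> 0)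
  (fun k _ => is_derive_cst (Acoef ai (n - k)) a 1).
apply: (bracket_is_eq
  (bracket_isM (flow_Py ai eps xi nu a y pa py) fA)).
by rewrite big1 ?mulr0 ?mul0r ?addr0 // => k _; rewrite !mul0r.
Qed.

(** The Leibniz rule gives [m (py^2 hom B - pi0^2 hom D)], which [hom_ode] reduces to a multiple of
    [hom F]; then [m x' = a]. *)
Lemma flow_Q1 : flow (Q1 ai eps xi nu) (2 * a * py ^+ 2 * hom F).
Proof.
apply: (bracket_is_ext _ (fun _ _ _ _ => esym (Q1E _ _ _ _))).
have fB : flow (homsum ai eps xi nu (btil ai eps xi nu))
    (- (2 * pi0 * m) * hom ((2^-1)%:P * D)).
  have dB k : (k <= n)%N ->
      is_derive a 1 (btil ai eps xi nu k) ((2^-1)%:P * D)`_(n - k).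
    by move=> kn; rewrite coefCM mulrC; exact: is_derive_btil.
  exact: (flow_homsum ai eps xi nu a y pa py eps_neq0 Dnear xdot_neq0 _ _ dB).
apply: (bracket_is_eq
  (bracket_isM (flow_Pi ai eps xi nu a y pa py eps_neq0 Dnear xdot_neq0) fB)).
rewrite homsum_btil homCM -/m -[X in _ + X]mulrA hom_ode /Pi -/m -/pi0 /m.
by move: (hom D) (hom F) => x z; field.
Qed.

Lemma flow_Q2 : flow (Q2 ai eps xi nu) (2 * a * py * Q1 ai eps xi nu a y pa py).
Proof.
apply: (bracket_is_ext _ (fun _ _ _ _ => esym (Q2E _ _ _ _))).
have fC : flow (homsum ai eps xi nu (ctil ai eps xi nu))
    (- (2 * pi0 * m) * hom ((- xdot ai eps xi nu a)%:P * B)).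
  have dC k : (k <= n)%N -> is_derive a 1 (ctil ai eps xi nu k)
      ((- xdot ai eps xi nu a)%:P * B)`_(n - k).
    by move=> kn; rewrite coefCM; exact: is_derive_ctil.
  exact: (flow_homsum ai eps xi nu a y pa py eps_neq0 Dnear xdot_neq0 _ _ dC).
apply: (bracket_is_eq
  (bracket_isM (flow_Py ai eps xi nu a y pa py) fC)).
rewrite Q1E homsum_btil homCM mul0r addr0 /Py /Pi -/m -/pi0 /m.
by move: (hom B) => x; field.
Qed.

Lemma GE : Gfun ai eps xi nu a y pa py = py * hom F.
Proof. by rewrite GfunE. Qed.

Lemma flow_S1 : flow (S1 ai eps xi nu) 0.
Proof.
apply: (bracket_is_eq (bracket_isD flow_Q1
  (bracket_isM (flow_y ai eps xi nu a y pa py) flow_G))).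
by rewrite GE; move: (hom F) => x; ring.
Qed.

(** The brackets telescope: [{H, y} = - 2 a Py] makes [y Q1] cancel the bracket of [Q2], and
    [y^2 G / 2] cancel the remaining [2 a Py y G]. *)
Lemma flow_S2 : flow (S2 ai eps xi nu) 0.
Proof.
have fy := flow_y ai eps xi nu a y pa py.
have fy2 := bracket_isM
  (bracket_isX 2 fy) (bracket_is_cst H a y pa py 2^-1).
apply: (bracket_is_eq (bracket_isD
  (bracket_isD flow_Q2
    (bracket_isM fy flow_Q1))
  (bracket_isM fy2 flow_G))).
rewrite GE /=; move: (hom F) (Q1 _ _ _ _ _ _ _ _) => x z.
by field.
Qed.

End Conservation.

(** * Functional independence on a dense set *)

Section Independence.
Context {R : realType} {n : nat}.
Variables (ai eps xi : 'I_n -> R) (nu : R).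
Local Notation H := (Ham ai eps xi nu).

(** Among [size p] distinct points at least one is not a root. The points [x + e / (k + 2)] are
    distinct and lie strictly within [e] of [x]. *)
Lemma nonroot_near (p : {poly R}) (x e : R) : p != 0 -> 0 < e ->
  exists2 x', `|x' - x| < e & p.[x'] != 0.
Proof.
move=> p0 e0; pose g k : R := x + e / k.+2%:R.
have g_near k : `|g k - x| < e.
  rewrite /g addrC addKr gtr0_norm ?divr_gt0 ?ltr0n //.
  by rewrite ltr_pdivrMr ?ltr0n // ltr_pMr // ltr1n.
have [/allP all_root|/allPn[_ /mapP[k _ ->]]] :=
    boolP (all (root p) [seq g k | k <- iota 0 (size p)]); last by exists (g k).
have := max_poly_roots p0 (introT allP all_root).
rewrite size_map size_iota ltnn map_inj_uniq ?iota_uniq; first by move=> /(_ isT).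
move=> j k /addrI/(mulfI (lt0r_neq0 e0))/invr_inj/eqP.
by rewrite eqr_nat => /eqP[].
Qed.

(** A row vector killing the Jacobian is zero: the [y] column kills its third entry, then the [P_a]
    column the first, then the [P_y] column the second. *)
Lemma rank_jac3_Py (f g : pfun R) a y pa py :
  d_y f a y pa py = 0 -> d_Pa f a y pa py != 0 -> d_y g a y pa py != 0 ->
  \rank (jac3 f (@Py R) g a y pa py) = 3%N.
Proof.
move=> fy fpa gy; apply/eqP; rewrite -/(row_free _) -kermx_eq0.
apply/rowV0P => v /sub_kermxP vJ.
have Pyy : d_y (@Py R) a y pa py = 0.
  exact: (is_derive_derive1 (is_derive_cst py y 1)).
have Pypa : d_Pa (@Py R) a y pa py = 0.
  exact: (is_derive_derive1 (is_derive_cst py pa 1)).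
have Pypy : d_Py (@Py R) a y pa py = 1.
  exact: (is_derive_derive1 (is_derive_id py (1 : R))).
have col (j : 'I_4) : \sum_i v 0 i * jac3 f (@Py R) g a y pa py i j = 0.
  by have /matrixP/(_ 0 j) := vJ; rewrite !mxE.
have := col (@Ordinal 4 1 isT); have := col (@Ordinal 4 2 isT).
have := col (@Ordinal 4 3 isT); rewrite !big_ord_recl !big_ord0 !mxE /=.
rewrite fy Pyy Pypa Pypy !mulr0 !add0r !addr0 mulr1 => c3 c2 /eqP.
rewrite mulf_eq0 (negPf gy) orbF => /eqP v2.
move: c2 c3; rewrite v2 !mul0r !addr0 => /eqP.
rewrite mulf_eq0 (negPf fpa) orbF => /eqP v0; rewrite v0 mul0r add0r => v1.
apply/rowP => i; rewrite mxE; case: i => [[|[|[|//]]]] lti.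
- by rewrite -v0; congr (v _ _); apply: val_inj.
- by rewrite -v1; congr (v _ _); apply: val_inj.
- by rewrite -v2; congr (v _ _); apply: val_inj.
Qed.

Lemma is_derive_affine (c d t : R) : is_derive t 1 (fun s => c + s * d) d.
Proof.
apply: (is_derive_eq (is_derive_add (is_derive_cst c t 1)
  (is_derive_mulr d (is_derive_id t (1 : R))))).
by rewrite mul1r add0r.
Qed.

(** [G] and [Q1] do not involve [y], so the 0 in the place of [y] is an arbitrary choice. *)
Lemma d_y_S1 a y pa py :
  d_y (S1 ai eps xi nu) a y pa py = Gfun ai eps xi nu a 0 pa py.
Proof.
exact: (is_derive_derive1
  (is_derive_affine (Q1 ai eps xi nu a 0 pa py) (Gfun ai eps xi nu a 0 pa py) y)).
Qed.

Lemma d_y_S2 a y pa py : d_y (S2 ai eps xi nu) a y pa py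
  = Q1 ai eps xi nu a 0 pa py + y * Gfun ai eps xi nu a 0 pa py.
Proof.
set q1 := Q1 _ _ _ _ _ _ _ _; set g := Gfun _ _ _ _ _ _ _ _.
have dy2 := is_derive_mul (is_derive_id y (1 : R)) (is_derive_id y (1 : R)).
have d := is_derive_add
  (is_derive_affine (Q2 ai eps xi nu a 0 pa py) q1 y)
  (is_derive_mulr g (is_derive_mulr 2^-1 dy2)).
transitivity (q1 + (y * 1 + 1 * y) * 2^-1 * g); last by field.
exact: (is_derive_derive1 d).
Qed.

Lemma Gfun_neq0_near (a pa py e : R) :
  a / xdot ai eps xi nu a != 0 -> 0 < e ->
  exists pa' py', [/\ `|pa' - pa| < e, `|py' - py| < e, pa' != 0 &
    Gfun ai eps xi nu a 0 pa' py' != 0].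
Proof.
move=> m0 e0; have X0 : 'X != 0 :> {poly R} by rewrite polyX_eq0.
have [q qe] := nonroot_near _ py _ X0 e0; rewrite hornerX => q0.
(* For the chosen nonzero [q], the polynomial [r] is [H / q^2] as a function of [P_a]. *)
set m := a / _ in m0; pose r := ((m / q) ^+ 2)%:P * 'X^2 + a%:P.
have c0 : (m / q) ^+ 2 != 0 by rewrite expf_neq0 // mulf_neq0 ?invr_eq0.
have r1 : (1 < size r)%N.
  rewrite /r mul_polyC size_polyDl size_scale // size_polyXn //.
  by rewrite (leq_ltn_trans (size_polyC_leq1 _)).
(* [r] is not constant, so [F] composed with [r] is nonzero; the factor ['X] also forces the chosen
   [P_a] to be nonzero. *)
have p0 : 'X * (Fpoly ai \Po r) != 0.
  by rewrite mulf_neq0 // comp_poly_eq0 // monic_neq0 // monic_prod_XsubC.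
have [p pe] := nonroot_near _ pa _ p0 e0.
rewrite hornerM hornerX horner_comp mulf_eq0 negb_or => /andP[pa0 F0].
exists p, q; split => //.
rewrite GE hom_horner ?size_Fpoly // mulf_neq0 // mulf_neq0 ?expf_neq0 //.
suff -> : Ham ai eps xi nu a 0 p q / q ^+ 2 = r.[p] by [].
rewrite /r hornerD hornerCM hornerXn hornerC /Ham /Pi -/m.
by field.
Qed.

(** The coordinate [a] is kept, so the new point stays over [I]: the momenta move to make [G] and
    [P_a] nonzero, then [y] moves to make [d_y S] nonzero. *)
Lemma funct_indep_Ham (I : set R) (S : pfun R) :
  (forall t, I t -> t / xdot ai eps xi nu t != 0) ->
  (forall t y pa py e, Gfun ai eps xi nu t 0 pa py != 0 -> 0 < e ->
    exists2 y', `|y' - y| < e & d_y S t y' pa py != 0) ->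
  funct_indep I H (@Py R) S.
Proof.
move=> mI SG a y pa py Ia e e0; have m0 := mI a Ia.
have [pa' [py' [pae pye pa0 G0]]] := Gfun_neq0_near a pa py e m0 e0.
have [y' ye Sy] := SG a y pa' py' e G0 e0.
exists a, y', pa', py'; split; first by split=> //; rewrite subrr normr0.
apply: rank_jac3_Py => //; first exact: d_y_Ham.
have two0 : 2 != 0 :> R by rewrite pnatr_eq0.
by rewrite d_Pa_Ham; exact: mulf_neq0 (mulf_neq0 two0 (mulf_neq0 m0 pa0)) m0.
Qed.

Lemma funct_indep_S1 (I : set R) :
  (forall t, I t -> t / xdot ai eps xi nu t != 0) ->
  funct_indep I H (@Py R) (S1 ai eps xi nu).
Proof.
move=> mI; apply: funct_indep_Ham => // t y pa py e G0 e0.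
by exists y; rewrite ?subrr ?normr0 // d_y_S1.
Qed.

Lemma funct_indep_S2 (I : set R) :
  (forall t, I t -> t / xdot ai eps xi nu t != 0) ->
  funct_indep I H (@Py R) (S2 ai eps xi nu).
Proof.
move=> mI; apply: funct_indep_Ham => // t y pa py e G0 e0.
pose g := Gfun ai eps xi nu t 0 pa py; pose q := Q1 ai eps xi nu t 0 pa py.
(* [d_y S2] is affine in [y] with slope [g], which is nonzero. *)
have p0 : g%:P * 'X + q%:P != 0.
  rewrite -size_poly_gt0 size_MXaddC polyC_eq0 (negPf G0) /=.
  by rewrite ltnS.
have [y' ye] := nonroot_near _ y _ p0 e0; rewrite !hornerE => yG.
by exists y' => //; rewrite d_y_S2 addrC mulrC.
Qed.

End Independence.

(** * Openness of the interval and assembly of the results *)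

Lemma near_open_eitv {R : realType} (l r : \bar R) (a : R) :
  (l < a%:E)%E -> (a%:E < r)%E ->
  \forall t \near a, (l < t%:E)%E /\ (t%:E < r)%E.
Proof.
move=> la ar; near=> t; split; near: t.
- case: l la => [l| |] //; last by move=> _; near=> t; rewrite ltNyr.
  by rewrite lte_fin => /lt_nbhsr; apply: filterS => t; rewrite lte_fin.
- case: r ar => [r| |] //; last by move=> _; near=> t; rewrite ltry.
  by rewrite lte_fin => /lt_nbhsl; apply: filterS => t; rewrite lte_fin.
Unshelve. all: by end_near. Qed.

Theorem theorem2 (R : realType) (n : nat) (ai : 'I_n -> R)
  (eps xi : 'I_n -> R) (nu : R) (l r : \bar R) :
  (0 < n)%N ->
  injective ai ->
  (forall i, eps i = 1 \/ eps i = -1) ->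
  (0 <= l)%E -> (l < r)%E ->
  (forall a : R, (l < a%:E)%E -> (a%:E < r)%E ->
     (forall i, 0 < Delta ai eps i a) /\ xdot ai eps xi nu a != 0) ->
  let I : set R := fun a => (l < a%:E)%E /\ (a%:E < r)%E in
  let H := Ham ai eps xi nu in
  (forall a y pa py, I a ->
     [/\ pbracket H (@Py R) a y pa py = 0,
         pbracket H (S1 ai eps xi nu) a y pa py = 0 &
         pbracket H (S2 ai eps xi nu) a y pa py = 0]) /\
  funct_indep I H (@Py R) (S1 ai eps xi nu) /\
  funct_indep I H (@Py R) (S2 ai eps xi nu).
Proof.
move=> _ _ eps1 l0 _ good I H.
have eps_neq0 i : eps i != 0 by case: (eps1 i) => ->; rewrite ?oppr_eq0 oner_eq0.
have mI t : I t -> t / xdot ai eps xi nu t != 0.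
  move=> [lt tr]; have [_ x0] := good t lt tr.
  have t0 : 0 < t by rewrite -lte_fin (le_lt_trans l0).
  by rewrite mulf_neq0 ?invr_eq0 // gt_eqF.
split; last by split; [exact: funct_indep_S1|exact: funct_indep_S2].
move=> a y pa py [la ar]; have [_ x0] := good a la ar.
(* The interval is open, so the positivity assumed on it holds on a neighbourhood of [a], as the
   derivatives at [a] require. *)
have Dnear : \forall t \near a, forall i, 0 < Delta ai eps i t.
  by apply: filterS (near_open_eitv _ _ _ la ar) => t [lt tr]; case: (good t lt tr).
split.
- by case: (flow_Py ai eps xi nu a y pa py).
- by case: (flow_S1 ai eps xi nu a y pa py eps_neq0 Dnear x0).
- by case: (flow_S2 ai eps xi nu a y pa py eps_neq0 Dnear x0).
Qed.
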